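(* Let $p_1,\dots,p_m$ be pairwise distinct primes, for each $i$ let $S_i$ be a finite $p_i$-group, and let $\mathcal{F}_{S_i}$ be a fusion system over $S_i$. Then there exists a group $G$ such that for every $i=1,\dots,m$, $S_i$ is a Sylow $p_i$-subgroup of $G$ and $\mathcal{F}_{S_i}(G)=\mathcal{F}_{S_i}$.
   Context: A fusion system $\mathcal{F}$ on a finite $p$-group $S$ is a category whose objects are all subgroups of $S$, such that for all $P,Q\le S$ the set $Hom_{\mathcal{F}}(P,Q)$ consists of injective group homomorphisms $P\to Q$, contains all homomorphisms $x\mapsto gxg^{-1}$ with $g\in S$, $gPg^{-1}\le Q$, and each morphism is the composite of an isomorphism in $\mathcal{F}$ followed by an inclusion. (No saturation is assumed.) For a possibly infinite group $G$, a finite subgroup $S\le G$ is a Sylow $p$-subgroup of $G$ if $S$ is a $p$-group and every $p$-subgroup of $G$ is conjugate to a subgroup of $S$. For a finite $p$-subgroup $S\le G$, $\mathcal{F}_S(G)$ is the category whose objects are the subgroups of $S$ and whose morphisms $P\to Q$ are the maps $c_g:x\mapsto gxg^{-1}$ for $g\in G$ with $gPg^{-1}\le Q$. *)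

(* Defs.v *)
From HB Require Import structures.
From mathcomp Require Import all_boot all_order all_fingroup all_solvable.
Set Implicit Arguments. Unset Strict Implicit. Unset Printing Implicit Defensive.

Local Open Scope group_scope.

Record AbsGroup := MkGroup {
  gcar :> Type;
  gmul : gcar -> gcar -> gcar;
  ginv : gcar -> gcar;
  gone : gcar;
  gmulA : forall x y z, gmul x (gmul y z) = gmul (gmul x y) z;
  gmul1 : forall x, gmul gone x = x;
  gmulV : forall x, gmul (ginv x) x = gone
}.

Fixpoint gpow (G : AbsGroup) (x : G) (n : nat) : G :=
  match n with O => gone G | S n => gmul x (gpow x n) end.

Definition gconj (G : AbsGroup) (g x : G) : G := gmul (gmul g x) (ginv g).

Definition is_subgroup (G : AbsGroup) (H : G -> Prop) :=
  [/\ H (gone G), (forall x y, H x -> H y -> H (gmul x y)) &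
      (forall x, H x -> H (ginv x))].

Definition p_subgroup (G : AbsGroup) (p : nat) (H : G -> Prop) :=
  is_subgroup H /\ forall h, H h -> exists k, gpow h (p ^ k) = gone G.

Definition embeds (gT : finGroupType) (S : {group gT}) (G : AbsGroup) (iota : gT -> G) :=
  {in S &, forall x y, iota (x * y) = gmul (iota x) (iota y)} /\
  {in S &, injective iota}.

Definition is_Sylow_in (G : AbsGroup) (p : nat) (gT : finGroupType) (S : {group gT})
    (iota : gT -> G) :=
  [/\ p.-group S, embeds S iota &
      forall H : G -> Prop, @p_subgroup G p H ->
        exists g : G, forall h, H h -> exists2 s, s \in S & iota s = gconj g h].

(* ---------- Fusion systems (saturation not assumed) ---------- *)
(* A morphism P -> Q is represented as a finite function gT -> gT which is
   trivial (= 1) outside P, and restricts to an injective homomorphism P -> Q. *)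
Definition hom_into (gT : finGroupType) (P Q : {set gT}) (f : {ffun gT -> gT}) :=
  [/\ {in ~: P, forall x, f x = 1},
      {in P &, {morph f : x y / x * y}},
      {in P &, injective f} &
      f @: P \subset Q].

(* c_g restricted to P : x |-> g x g^-1 = x ^ g^-1 *)
Definition conj_map (gT : finGroupType) (P : {set gT}) (g : gT) : {ffun gT -> gT} :=
  [ffun x => if x \in P then x ^ g^-1 else 1].

Definition comp_map (gT : finGroupType) (P : {set gT}) (h f : {ffun gT -> gT})
  : {ffun gT -> gT} := [ffun x => if x \in P then h (f x) else 1].

Record fusion_system (gT : finGroupType) (S : {group gT}) := FusionSystem {
  fhom : {group gT} -> {group gT} -> {set {ffun gT -> gT}};
  fs_hom : forall P Q : {group gT}, P \subset S -> Q \subset S ->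
    forall f, f \in fhom P Q -> hom_into P Q f;
  fs_conj : forall P Q : {group gT}, P \subset S -> Q \subset S ->
    forall g, g \in S -> P :^ g^-1 \subset Q -> conj_map P g \in fhom P Q;
  (* category: closed under composition (identities are conj_map P 1) *)
  fs_comp : forall P Q R : {group gT}, P \subset S -> Q \subset S -> R \subset S ->
    forall f h, f \in fhom P Q -> h \in fhom Q R -> comp_map P h f \in fhom P R;
  fs_iso : forall P Q R : {group gT}, P \subset S -> Q \subset S -> R \subset S ->
    forall f, f \in fhom P Q -> (R :=: f @: P) ->
      f \in fhom P R /\
      exists2 h, h \in fhom R P & {in P, forall x, h (f x) = x}
}.

(* Membership of f in Hom_{F_S(G)}(P, Q), where S is identified with iota(S):
   f is (the transport of) some c_g, g in G, with g P g^-1 <= Q. *)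
Definition in_FSG (gT : finGroupType) (G : AbsGroup) (iota : gT -> G)
    (P Q : {set gT}) (f : {ffun gT -> gT}) :=
  {in ~: P, forall x, f x = 1} /\
  exists g : G, {in P, forall x, f x \in Q /\ iota (f x) = gconj g (iota x)}.

(* Main.v *)
Require Import Defs.
From HB Require Import structures.
From mathcomp Require Import all_boot all_order all_fingroup all_solvable.
From mathcomp Require Import boolp.

(** Let [K] be the direct product of the [S i], and let [G] be the multiple HNN
    extension of [K] with one stable letter [t] for every isomorphism [f : P -> Q]
    of some [F i], subject to [t x t^-1 = f x] for [x] in [P].

    By Britton's lemma a reduced word containing a stable letter is not in [K].
    Hence, if [g] conjugates a subgroup [P] of [K] into [K], every stable letter
    of a reduced word for [g] can be pinched, so conjugation by [g] on [P] is a
    composite of conjugations in [K] and of the maps [f].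

    Sylow property: let [H] be a torsion subgroup of [G], acting on the
    Bass-Serre tree, whose vertices are the cosets of [K]. Choose a vertex with
    [H]-stabiliser [L] of maximal order. For [h] in [H], which fixes a vertex
    since it has finite order, take a point fixed by [L] and a point fixed by [h]
    at minimal distance. If they differ, some [h * k] with [k] in [L] is
    hyperbolic, hence of infinite order; so they agree and maximality gives [h]
    in [L]. Thus [H] is conjugate into [K], and a [p i]-subgroup of [K] lies in
    [S i]. *)

Set Implicit Arguments.
Unset Strict Implicit.
Unset Printing Implicit Defensive.

Local Open Scope group_scope.


(* The stable letters satisfy [t_(bar j) = t_j^-1] and
   [t_j * a * t_j^-1 = twist j a] for [a] in [assoc j]. *)
Record hnn_data := HNNData {
  hbase : finGroupType;
  hletter : choiceType;
  bar : hletter -> hletter;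
  assoc : hletter -> {group hbase};
  twist : hletter -> hbase -> hbase;
  barK : involutive bar;
  bar_neq : forall j, bar j != j;
  twist_assoc : forall j, {in assoc j, forall a, twist j a \in assoc (bar j)};
  twistM : forall j, {in assoc j &, {morph twist j : a b / a * b}};
  twistK : forall j, {in assoc j, cancel (twist j) (twist (bar j))}
}.

(** * Normal forms and the action of the generators on them *)

Section NormalForms.

Variable D : hnn_data.
Notation K := (hbase D).
Notation J := (hletter D).
Implicit Types (j : J) (k a r : K) (w l : seq (J * K)) (u v x : K * seq (J * K)).

Definition no_pinch : rel (J * K) :=
  [rel s s' | ~~ ((s'.1 == bar s.1) && (s.2 \in assoc s.1))].

Definition rep j k := repr (assoc j :* k).

Lemma rep_in j k : k * (rep j k)^-1 \in assoc j.
Proof.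
by rewrite -mem_rcoset rcoset_sym mem_repr_rcoset.
Qed.

Lemma repM j a k : a \in assoc j -> rep j (a * k) = rep j k.
Proof. by move=> aj; rewrite /rep rcosetM (rcoset_id aj). Qed.

Lemma rep_id j k : rep j (rep j k) = rep j k.
Proof. by rewrite {1}/rep rcoset_repr. Qed.

Lemma rep_assoc j k : (rep j k \in assoc j) = (k \in assoc j).
Proof. by rewrite -(groupMl (rep j k) (rep_in j k)) mulgVK. Qed.

Lemma twist1 j : twist j 1 = 1 :> K.
Proof. by apply: (mulgI (twist j 1)); rewrite -twistM ?group1 // !mulg1. Qed.

(* [(k, [:: (j_1, r_1); ...; (j_n, r_n)])] encodes
   [k * t_(j_1) * r_1 * ... * t_(j_n) * r_n]; the coset representative chosen by
   [repr] for [assoc j] itself is [1]. *)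
Definition is_nf u :=
  all (fun s : J * K => rep s.1 s.2 == s.2) u.2 && sorted no_pinch u.2.

Definition kact k u := (k * u.1, u.2).

(** Left multiplication by [t_j]: either [t_j] cancels against a leading [t_(bar j)], or the part of
    [u.1] in [assoc j] passes to the left of [t_j] and only the coset representative stays
    behind. *)
Definition tact j u : K * seq (J * K) :=
  let push := (twist j (u.1 * (rep j u.1)^-1), (j, rep j u.1) :: u.2) in
  if (u.1 \in assoc j) && (ohead (map fst u.2) == Some (bar j)) then
    if u.2 is (_, r) :: w then (twist j u.1 * r, w) else push
  else push.

Lemma no_pinch_head j r w : path no_pinch (j, r) w ->
  (r \in assoc j) && (ohead (map fst w) == Some (bar j)) = false.
Proof.
case: w => [|[j' r'] w] /=; first by rewrite andbF.
by case/andP=> + _; rewrite andbC => /negPf.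
Qed.

Lemma kactM k k' u : kact (k * k') u = kact k (kact k' u).
Proof. by rewrite /kact mulgA. Qed.

Lemma kact1 u : kact 1 u = u.
Proof. by case: u => k w; rewrite /kact mul1g. Qed.

Lemma is_nf_tact j u : is_nf u -> is_nf (tact j u).
Proof.
case: u => k w nfu; rewrite /tact /=; case: ifPn => [/andP[_]|].
  case: w nfu => //= -[j' r] w /andP[/= /andP[_ aw] sw] _.
  by rewrite /is_nf /= aw (path_sorted sw).
move=> npinch; case/andP: nfu => /= aw sw.
rewrite /is_nf /= rep_id eqxx aw /=.
case: w sw npinch {aw} => //= -[j' r'] w -> /=.
by rewrite andbT /no_pinch /= rep_assoc andbC.
Qed.

Lemma tactM j a u : a \in assoc j -> tact j (kact a u) = kact (twist j a) (tact j u).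
Proof.
case: u => k w aj; rewrite /tact /= repM // groupMl //.
have E : twist j (a * k * (rep j k)^-1) = twist j a * twist j (k * (rep j k)^-1).
  by rewrite -mulgA (twistM aj (rep_in j k)).
case: ifPn => [/andP[kj]|_]; last by rewrite /kact /= E.
case: w => [|[j' r] w] //= _.
by rewrite /kact /= twistM // mulgA.
Qed.

(** Normality matters when [t_j] cancels a letter: pushing [t_(bar j)] back restores the same word
    because its coefficient is its own representative and the rest starts without a pinch. *)
Lemma tactK j u : is_nf u -> tact (bar j) (tact j u) = u.
Proof.
case: u => k w nfu; rewrite {2}/tact /=; case: ifPn => [/andP[kj]|_].
  case: w nfu => //= -[j' r] w /andP[/= /andP[/eqP rr aw] sw] /eqP[jj].
  subst j'; have tj := twist_assoc kj.
  rewrite /tact /= repM // rr mulgK twistK // groupMl //.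
  by rewrite no_pinch_head.
rewrite /tact /= barK eqxx twist_assoc ?rep_in //=.
by rewrite twistK ?rep_in // mulgVK.
Qed.

Lemma tact_push j r w : is_nf (1, (j, r) :: w) -> tact j (r, w) = (1, (j, r) :: w).
Proof.
case/andP=> /= /andP[/eqP rr _] sw; rewrite /tact /= rr mulgV twist1.
by rewrite no_pinch_head.
Qed.

(** The group law is put on the normal forms themselves, letting the left factor act letter by
    letter on the right one. Uniqueness of normal forms is then built in, and associativity is what
    needs proof. *)
Definition wact w u := foldr (fun s v => tact s.1 (kact s.2 v)) u w.
Definition nf_mul u v := kact u.1 (wact u.2 v).
Definition nf_one : K * seq (J * K) := (1, [::]).

Fixpoint winv w :=
  if w is (j, r) :: w' then nf_mul (winv w') (kact r^-1 (tact (bar j) nf_one))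
  else nf_one.
Definition nf_inv u := nf_mul (winv u.2) (u.1^-1, [::]).

Lemma is_nf_wact w u : is_nf u -> is_nf (wact w u).
Proof. by move=> nfu; elim: w => //= -[j r] w IH; exact/is_nf_tact. Qed.

Lemma is_nf_mul u v : is_nf v -> is_nf (nf_mul u v).
Proof. exact: is_nf_wact. Qed.

Lemma is_nf_inv u : is_nf (nf_inv u).
Proof. exact: is_nf_mul. Qed.

Lemma nf_mul_kact k u v : nf_mul (kact k u) v = kact k (nf_mul u v).
Proof. by rewrite /nf_mul kactM. Qed.

(** The core of associativity. If [t_j] is pushed onto [u], the relation [tactM] suffices; if it
    cancels the first letter of [u], the two successive actions on [v] cancel by [tactK]. *)
Lemma nf_mul_tact j u v : is_nf v -> nf_mul (tact j u) v = tact j (nf_mul u v).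
Proof.
move=> nfv; case: u => k w; rewrite /nf_mul /=.
have push : tact j (kact k (wact w v)) =
  kact (twist j (k * (rep j k)^-1)) (tact j (kact (rep j k) (wact w v))).
  by rewrite -tactM ?rep_in // -kactM mulgVK.
rewrite {1 2}/tact [(k, w).1]/= [(k, w).2]/=.
case: ifPn => [/andP[kj]|_]; last by rewrite push.
case: w {push} => //= -[j' r] w /eqP[jj]; subst j'.
have := tactK (bar j) (is_nf_wact w nfv : is_nf (kact r _)).
by rewrite barK (tactM _ kj) kactM => ->.
Qed.

Lemma nf_mulA u v x : is_nf x -> nf_mul u (nf_mul v x) = nf_mul (nf_mul u v) x.
Proof.
move=> nfx; case: u => k s; 
rewrite -[LHS]/(kact k (wact s _)) -[nf_mul (k, s) v]/(kact k (wact s v)) nf_mul_kact.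
congr kact.
by elim: s => //= -[j r] s ->; rewrite nf_mul_tact // nf_mul_kact.
Qed.

Lemma nf_mul1 u : is_nf u -> nf_mul u nf_one = u.
Proof.
case: u => k w nfu; rewrite /nf_mul /=.
suff -> : wact w nf_one = (1, w) by rewrite /kact mulg1.
elim: w nfu => //= -[j r] w IH nfu.
rewrite IH; last first.
  by case/andP: nfu => /= /andP[_ aw] /path_sorted sw; rewrite /is_nf /= aw.
by rewrite /kact mulg1 tact_push.
Qed.

Lemma nf_1mul u : nf_mul nf_one u = u.
Proof. exact: kact1. Qed.

Lemma nf_mulV u : is_nf u -> nf_mul (nf_inv u) u = nf_one.
Proof.
case: u => k w nfu; rewrite /nf_inv -nf_mulA //.
rewrite [nf_mul (_, [::]) _]/(kact _ (k, w)) /kact /= mulVg.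
have {}nfu : is_nf (1, w) := nfu.
elim: w nfu => [|[j r] w IH] nfu; first by rewrite nf_1mul.
have nfw : is_nf (1, w).
  by case/andP: nfu => /= /andP[_ aw] /path_sorted sw; rewrite /is_nf /= aw.
rewrite /= -nf_mulA // nf_mul_kact nf_mul_tact // nf_1mul -tact_push // tactK //.
by rewrite /kact /= mulVg IH.
Qed.

(** * The HNN extension as a group *)

Record hnn := HNN { nf_val : K * seq (J * K); _ : is_nf nf_val }.
HB.instance Definition _ := [isSub for nf_val].
HB.instance Definition _ := [Choice of hnn by <:].

Definition hnn_mul (g h : hnn) : hnn := HNN (is_nf_mul (val g) (valP h)).
Definition hnn_one : hnn := @HNN nf_one isT.
Definition hnn_inv (g : hnn) : hnn := HNN (is_nf_inv (val g)).

Lemma hnn_mulA : associative hnn_mul.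
Proof. by move=> g h i; apply/val_inj/nf_mulA/valP. Qed.
Lemma hnn_1mul : left_id hnn_one hnn_mul.
Proof. by move=> g; apply/val_inj/nf_1mul. Qed.
Lemma hnn_mul1 : right_id hnn_one hnn_mul.
Proof. by move=> g; apply/val_inj/nf_mul1/valP. Qed.
Lemma hnn_mulVg : left_inverse hnn_one hnn_inv hnn_mul.
Proof. by move=> g; apply/val_inj/nf_mulV/valP. Qed.
Lemma hnn_mulgV : right_inverse hnn_one hnn_inv hnn_mul.
Proof.
move=> g; rewrite -[hnn_mul _ _]hnn_1mul -{1}(hnn_mulVg (hnn_inv g)).
by rewrite -hnn_mulA [in X in hnn_mul _ X]hnn_mulA hnn_mulVg hnn_1mul hnn_mulVg.
Qed.

HB.instance Definition _ :=
  isGroup.Build hnn hnn_mulA hnn_1mul hnn_mul1 hnn_mulVg hnn_mulgV.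

Definition hin k : hnn := @HNN (k, [::]) isT.
Definition hst j : hnn := HNN (is_nf_tact j (isT : is_nf nf_one)).

Lemma val_hinM k g : val (hin k * g) = kact k (val g).
Proof. by []. Qed.

Lemma val_hstM j g : val (hst j * g) = tact j (val g).
Proof.
rewrite -[val _]/(nf_mul (tact j nf_one) (val g)).
by rewrite (nf_mul_tact _ _ (valP g)) nf_1mul.
Qed.

Lemma hinM : {morph hin : k k' / k * k'}.
Proof. by move=> k k'; apply/val_inj. Qed.

Lemma hin_inj : injective hin.
Proof. by move=> k k' [->]. Qed.

Lemma hst_bar j : hst (bar j) = (hst j)^-1.
Proof.
apply: (mulIg (hst j)); rewrite mulVg.
by apply/val_inj; rewrite val_hstM; apply: tactK.
Qed.

Lemma hst_hin j a : a \in assoc j -> hst j * hin a = hin (twist j a) * hst j.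
Proof.
move=> aj; apply/val_inj; rewrite val_hstM val_hinM.
have -> : val (hin a) = kact a nf_one by rewrite /kact mulg1.
by rewrite tactM.
Qed.

Lemma hst_hinJ j a : a \in assoc j -> hst j * hin a * hst (bar j) = hin (twist j a).
Proof. by move=> aj; rewrite hst_hin // hst_bar mulgK. Qed.

Lemma hin1 : hin 1 = 1.
Proof. by []. Qed.

Lemma hinV k : hin k^-1 = (hin k)^-1.
Proof. by apply: (mulIg (hin k)); rewrite -hinM !mulVg. Qed.

(** * Words in the stable letters and Britton's lemma *)

Definition ev l : hnn := \prod_(s <- l) (hst s.1 * hin s.2).

Lemma ev_nil : ev [::] = 1.
Proof. exact: big_nil. Qed.

Lemma ev_cons j k l : ev ((j, k) :: l) = hst j * hin k * ev l.
Proof. exact: big_cons. Qed.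

Lemma ev_cat l l' : ev (l ++ l') = ev l * ev l'.
Proof. exact: big_cat. Qed.

Lemma ev_rcons l j k : ev (rcons l (j, k)) = ev l * (hst j * hin k).
Proof. by rewrite -cats1 ev_cat /ev big_seq1. Qed.

Lemma hnn_evP (g : hnn) : exists k l, sorted no_pinch l /\ g = hin k * ev l.
Proof.
case: g => -[k w] nfg; exists k, w; split; first by case/andP: (nfg).
apply/val_inj; rewrite val_hinM /=.
suff -> : val (ev w) = (1, w) by rewrite /kact /= mulg1.
elim: w nfg => [|[j r] w IH] nfg; first by rewrite ev_nil.
have nfw : is_nf (k, w).
  by case/andP: nfg => /= /andP[_ aw] /path_sorted sw; rewrite /is_nf /= aw.
by rewrite ev_cons -mulgA val_hstM val_hinM (IH nfw) /kact mulg1 tact_push.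
Qed.

(** Evaluating a reduced word from the right only ever pushes letters. The bound on [c] carries the
    induction: if the next letter to the left could cancel, [c] would lie in its associated
    subgroup, hence so would the coefficient between the two letters, contradicting reducedness. *)
Lemma val_ev_reduced j k l : sorted no_pinch ((j, k) :: l) ->
  exists c r w, c \in assoc (bar j) /\ val (ev ((j, k) :: l)) = (c, (j, r) :: w).
Proof.
elim: l j k => [|[j' k'] l IH] j k.
  move=> _; rewrite ev_cons ev_nil mulg1 val_hstM /= /tact /= andbF.
  by do 3!eexists; split; last reflexivity; exact/twist_assoc/rep_in.
case/andP=> np /IH[c [r [w [cj E]]]].
rewrite ev_cons -mulgA val_hstM val_hinM E /tact /= /kact /=.
case: ifPn => [/andP[kcj /eqP[jj]]|_]; last first.
  by do 3!eexists; split; last reflexivity; exact/twist_assoc/rep_in.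
move: np; rewrite /no_pinch /= jj eqxx /=.
by rewrite jj barK in cj; rewrite -(groupMr k cj) kcj.
Qed.

Lemma britton l k : sorted no_pinch l -> l != [::] -> ev l <> hin k.
Proof.
case: l => // -[j r] l /val_ev_reduced[c [r' [w [_ E]]]] _ ek.
by rewrite ek in E.
Qed.

Lemma ev_shorten l : ~~ sorted no_pinch l ->
  exists k l', size l' < size l /\ ev l = hin k * ev l'.
Proof.
elim: l => //= -[j r] [|[j' r'] l] IH //=.
rewrite negb_and; case: (boolP (path _ _ _)) => [_|np _] /=; last first.
  have [k [l' [sl' E]]] := IH np; exists 1, ((j, r * k) :: l').
  by split=> //; rewrite ev_cons E hin1 mul1g ev_cons hinM !mulgA.
rewrite orbF negbK => /andP[/= /eqP-> rj].
exists (twist j r * r'), l; split; first exact: leqnSn.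
by rewrite !ev_cons !mulgA hst_hinJ // hinM.
Qed.

(* A word spelling [ev s * t_j c t_j^-1 * (ev s)^-1 * k]. *)
Fixpoint pal (s : seq (J * K)) j c k :=
  if s is (i, r) :: s' then (i, r) :: rcons (pal s' j c r^-1) (bar i, k)
  else [:: (j, c); (bar j, k)].

Lemma ev_pal s j c k :
  ev (pal s j c k) = ev s * (hst j * hin c * hst (bar j)) * (ev s)^-1 * hin k.
Proof.
elim: s k => [|[i r] s IH] k /=.
  by rewrite !ev_cons !ev_nil invg1 mul1g !mulg1 !mulgA.
rewrite !ev_cons ev_rcons IH !hst_bar !invMg hinV !mulgA; congr (_ * _ * _).
Qed.

(** The centre is not a pinch by the choice of [c], and a pinch in the right half would mirror one
    in the left half. The first and last syllables are recorded in order to test the junction when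
    the word is closed up into a cycle. *)
Lemma path_pal s j c k (x0 : J * K) : c \notin assoc j -> sorted no_pinch (rcons s (j, c)) ->
  sorted no_pinch (pal s j c k) /\
  last x0 (pal s j c k) = (bar (head (j, c) s).1, k) /\
  head x0 (pal s j c k) = head (j, c) s.
Proof.
move=> cj; elim: s k => [|[i r] s IH] k /=.
  by move=> _; rewrite /no_pinch /= (negPf cj) andbF.
move=> ps; have {IH} [sp [lp hp]] := IH r^-1 (path_sorted ps).
rewrite last_rcons; split=> //.
have e1 : no_pinch (i, r) (head (j, c) s) by case: s ps {sp lp hp} => [|? ?] /= /andP[].
have : pal s j c r^-1 <> [::] by case: s {ps sp lp hp e1} => // -[].
case: (pal s j c r^-1) sp lp hp => // y p /= sp lp hp _.
have -> : no_pinch (i, r) y by rewrite hp.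
rewrite rcons_path sp lp /=.
move: e1; rewrite /no_pinch /=; apply: contra => /andP[/eqP/(can_inj (@barK D)) ->].
by rewrite barK groupV eqxx.
Qed.

Lemma cycle_powers l n : path.cycle no_pinch l -> sorted no_pinch (flatten (nseq n l)).
Proof.
case: l => [_|x p /= cp]; first by elim: n.
have pp : path no_pinch (last x p) (x :: p).
  by move: cp; rewrite rcons_path /= andbC.
suff : path no_pinch (last x p) (flatten (nseq n (x :: p))) by apply: path_sorted.
elim: n => // n IH.
have -> : flatten (nseq n.+1 (x :: p)) = (x :: p) ++ flatten (nseq n (x :: p)) by [].
by rewrite cat_path pp.
Qed.

(** Powers of a cyclically reduced word are reduced, so Britton's lemma keeps them out of the
    base. *)
Lemma cycle_torsionfree l n : path.cycle no_pinch l -> l != [::] -> 0 < n ->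
  ev l ^+ n <> 1.
Proof.
move=> cl l0 n0.
have -> : ev l ^+ n = ev (flatten (nseq n l)).
  by elim: n {n0} => [|n IH]; rewrite ?ev_nil // expgS IH -ev_cat.
rewrite -hin1; apply: britton; first exact: cycle_powers.
by case: n n0 l l0 {cl} => // n _ [].
Qed.

End NormalForms.

Lemma ex_minimal (P : nat -> Prop) :
  (exists n, P n) -> exists n, P n /\ forall m, P m -> n <= m.
Proof.
move=> exP; have exb : exists n, `[<P n>] by case: exP => n /asboolP; exists n.
case: (ex_minnP exb) => n /asboolP Pn nmin.
by exists n; split=> // m /asboolP; exact: nmin.
Qed.

Lemma conjgVE (G : groupType) (x y : G) : y ^ x^-1 = x * y * x^-1.
Proof. by rewrite conjgE invgK mulgA. Qed.

(** * Torsion in the HNN extension, and conjugation between subsets of the base *)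

Section Torsion.

Variable D : hnn_data.
Notation K := (hbase D).
Notation J := (hletter D).
Notation G := (hnn D).
Implicit Types (j : J) (k a c r : K) (l s : seq (J * K)) (g h x y z : G).

Lemma hinJ k k' : hin (k ^ k') = hin k ^ hin k' :> G.
Proof. by rewrite !conjgE !hinM hinV. Qed.

Lemma hin_val g k : g = hin k -> hin (val g).1 = g.
Proof. by move=> ->. Qed.

Lemma hst_conj j c : c \in assoc (bar j) ->
  hin c ^ hst j = hin (twist (bar j) c) :> G.
Proof. by move=> cj; rewrite conjgE -hst_bar mulgA -{2}(barK j) hst_hinJ. Qed.

(** Rotating by one exposes the junction of the last and first letters; for a single letter,
    [bar_neq] prevents a pinch with itself. *)
Lemma cyclically_reduced l :
  sorted (@no_pinch D) l -> sorted (@no_pinch D) (seq.rot 1%N l) -> path.cycle (@no_pinch D) l.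
Proof.
case: l => [//|s [|s' l]].
  by rewrite /= /no_pinch /= eq_sym (negPf (bar_neq _)).
by rewrite rot1_cons /= !rcons_path => /andP[-> ->] /andP[_ ->].
Qed.

(** A conjugate of [g] with the fewest stable letters either lies in the base or can be made
    cyclically reduced, which would give infinite order. *)
Lemma torsion_elliptic g n : 0 < n -> g ^+ n = 1 -> exists x k, g ^ x = hin k.
Proof.
move=> n0 gn.
have [|m [[x [k [l [<- El]]]] lmin]] :=
  @ex_minimal (fun m => exists x k l, size l = m /\ g ^ x = hin k * ev l).
  have [k [l [_ E]]] := hnn_evP g.
  by exists (size l), 1, k, l; rewrite conjg1.
have {x k l El lmin} [//|[x [l [l0 El lmin]]]] : (exists x k, g ^ x = hin k) \/
    exists x l, [/\ l != [::], g ^ x = ev l & forall x k l',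
      g ^ x = hin k * ev l' -> size l <= size l'].
  case/lastP: l El lmin => [|s [j r]] El lmin.
    by left; exists x, k; rewrite El ev_nil mulg1.
  (* Conjugating by [hin k] moves the leading coefficient to the end of the word. *)
  right; exists (x * hin k), (rcons s (j, r * k)); split.
  - by case: (s).
  - by rewrite conjgM El conjgE !mulgA mulVg mul1g !ev_rcons hinM !mulgA.
  move=> x' k' l' E'; rewrite size_rcons -(size_rcons s (j, r)).
  by apply: lmin; exists x', k', l'.
have reduced x' l' : size l' = size l -> g ^ x' = ev l' -> sorted (@no_pinch D) l'.
  move=> sl' El'; apply/negPn/negP => /ev_shorten[k [l2 [sl2 El2]]].
  by have := lmin x' k l2; rewrite -El2 -El' => /(_ erefl); rewrite -sl' leqNgt sl2.
have cl : path.cycle (@no_pinch D) l.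
  apply: cyclically_reduced; first exact: reduced El.
  case: l l0 El reduced {lmin} => // -[j r] l _ El reduced.
  (* Conjugating by the first syllable rotates the word. *)
  apply: (reduced (x * (hst j * hin r))); first by rewrite size_rot.
  rewrite rot1_cons conjgM El conjgE ev_cons ev_rcons.
  by rewrite -mulgA mulKg.
case: (@cycle_torsionfree D l n cl l0 n0).
by rewrite -El -conjXg gn conj1g.
Qed.

Lemma sorted_rcons_snd s j r c :
  sorted (@no_pinch D) (rcons s (j, r)) = sorted (@no_pinch D) (rcons s (j, c)).
Proof. by case: s => //= s0 s; rewrite !rcons_path. Qed.

Lemma torsion_subgroup_conj (H : G -> Prop) :
    (forall g h, H g -> H h -> H (g * h)) ->
    (forall g, H g -> exists2 n, 0 < n & g ^+ n = 1) ->
  exists x, forall h, H h -> exists k, h ^ x = hin k.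
Proof.
move=> HM Htor.
(* [St x] is the [H]-stabiliser of the vertex [x K], conjugated into [K]. *)
pose St x := [set k : K | `[<H (hin k ^ x^-1)>]].
have StP x k : reflect (H (hin k ^ x^-1)) (k \in St x) by rewrite inE; exact: asboolP.
have [x xmax] : exists x, forall y, #|St y| <= #|St x|.
  have [|n [[x <-] xmin]] := @ex_minimal (fun n => exists x, #|K| - #|St x| = n).
    by exists (#|K| - #|St 1|), 1.
  exists x => y; have := xmin _ (ex_intro _ y erefl).
  by rewrite leq_sub2lE // max_card.
exists x => h Hh.
(* The stabiliser of [x K] also fixes [y K]. The length of [l] below bounds the distance from [y K]
   to a vertex fixed by [h]. *)
pose fixes y := forall k, k \in St x -> exists k', (hin k ^ x^-1) ^ y = hin k'.
have [|n [[y [l [c [<- fy Ec]]]] lmin]] := @ex_minimal (fun n =>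
    exists y l c, [/\ size l = n, fixes y & h ^ (y * ev l) = hin c]).
  have [n n0 hn] := Htor h Hh; have [z [c Ec]] := torsion_elliptic n0 hn.
  have [k [l [_ E]]] := hnn_evP (x^-1 * z).
  exists (size l), (x * hin k), l, c; split=> //.
    by move=> k' _; exists (k' ^ k); rewrite conjgM conjgKV hinJ.
  by rewrite -mulgA -E mulVKg.
pose kap k := (val ((hin k ^ x^-1) ^ y)).1.
have kapE k : k \in St x -> hin (kap k) = (hin k ^ x^-1) ^ y.
  by move=> /fy[k' E]; exact: hin_val E.
case/lastP: l Ec lmin => [|s [j r]].
  (* At length zero, [kap] embeds [St x] in [St y]; by maximality it is onto, so [h] comes from
     [St x]. *)
  rewrite ev_nil mulg1 => Ec _.
  have cy : c \in St y by apply/StP; rewrite -Ec conjgK.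
  have sub : kap @: St x \subset St y.
    apply/subsetP=> _ /imsetP[k kx ->]; apply/StP.
    by rewrite kapE // conjgK; exact/StP.
  have inj : {in St x &, injective kap}.
    move=> k k' kx kx' E; apply: (@hin_inj D).
    by apply: (@conjg_inj _ x^-1); apply: (@conjg_inj _ y); rewrite -!kapE // E.
  have /setP Eq : kap @: St x = St y.
    by apply/eqP; rewrite eqEcard sub card_in_imset ?xmax.
  move: cy; rewrite -Eq => /imsetP[k kx ck]; exists k.
  by rewrite -[h](conjgK y) Ec ck kapE // conjgK conjgKV.
rewrite ev_rcons size_rcons !mulgA => Ec lmin; exfalso.
pose c' := c ^ r^-1.
have Ec' : h ^ (y * ev s * hst j) = hin c' by rewrite /c' hinJ -Ec hinV [in RHS]conjgM conjgK.
have hE : h ^ y = ev s * (hst j * hin c' * hst (bar j)) * (ev s)^-1.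
  by rewrite -Ec' hst_bar -!conjgVE 2!conjgM !conjgK.
have red : sorted (@no_pinch D) (rcons s (j, c')).
  apply/negPn/negP => /ev_shorten[k [l [sl E]]].
  suff /lmin : exists y' l' d, [/\ size l' = size l, fixes y' & h ^ (y' * ev l') = hin d].
    by rewrite leqNgt -(size_rcons s (j, c')) sl.
  exists (y * hin k), l, c'; split=> //.
    by move=> k' /fy[k2 E2]; exists (k2 ^ k); rewrite conjgM E2 hinJ.
  by rewrite -mulgA -E ev_rcons !mulgA conjgM Ec' -hinJ conjgE mulKg.
(* Otherwise [h] fixes the last edge of the path and a shorter path works. *)
have cj : c' \notin assoc j.
  apply/negP => cj; suff /lmin : exists y' l' d,
    [/\ size l' = size s, fixes y' & h ^ (y' * ev l') = hin d] by rewrite ltnn.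
  exists y, s, (twist j c'); split=> //.
  by rewrite conjgM hE hst_hinJ // conjgE !mulgA mulgVK mulVg mul1g.
pose i := (head (j, c') s).1.
(* Otherwise the stabiliser of [x K] fixes the first edge, and [y] can advance along it. *)
have [k kx ki] : exists2 k, k \in St x & kap k \notin assoc (bar i).
  apply: contrapT => noex.
  have all_in k : k \in St x -> kap k \in assoc (bar i).
    by move=> kx; apply/negPn/negP => ki; apply: noex; exists k.
  have [r1 [l El]] : exists r1 l, rcons s (j, c') = (i, r1) :: l.
    rewrite /i; case: (s) => [|[i1 r1] s'] /=; first by exists c', [::].
    by exists r1, (rcons s' (j, c')).
  suff /lmin : exists y' l' d, [/\ size l' = size l, fixes y' & h ^ (y' * ev l') = hin d].
    by rewrite -(size_rcons s (j, c')) El ltnn.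
  exists (y * (hst i * hin r1)), l, c'; split=> //.
    move=> k kx; exists (twist (bar i) (kap k) ^ r1).
    by rewrite hinJ -hst_conj ?all_in // kapE // !conjgM.
  by rewrite -mulgA -ev_cons -El ev_rcons !mulgA conjgM Ec' -hinJ conjgE mulKg.
have Hg : H (h * hin k ^ x^-1) by apply: HM => //; apply/StP.
have [e e0 ge] := Htor _ Hg.
have [sp [lp hp]] := path_pal (kap k) (j, c') cj red.
have p0 : pal s j c' (kap k) != [::] by case: (s) => // -[].
(* The conjugate by [y] of this product is spelled by [pal s j c' (kap k)]; [cj] keeps its centre
   and [ki] its closing junction from being pinches. *)
apply: (@cycle_torsionfree D (pal s j c' (kap k)) e _ p0 e0); last first.
  by rewrite ev_pal -hE kapE // -conjMg -conjXg ge conj1g.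
case: (pal _ _ _ _) p0 sp lp hp => // s1 p _ /= sp lp hp.
by rewrite rcons_path sp lp hp /no_pinch /= (negPf ki) andbF.
Qed.

(** An induction principle for conjugation by [g]: the last syllable of a reduced word for [g] acts
    first, and is peeled off as a conjugation in [K] followed by a twist. *)
Lemma conj_factor (P : {set K}) (R : (K -> K) -> Prop) :
    (forall f f', {in P, f =1 f'} -> R f -> R f') ->
    (forall f k, R f -> R (fun a => f a ^ k)) ->
    (forall f j, R f -> {in P, forall a, f a \in assoc j} ->
       R (fun a => twist j (f a))) ->
  forall g f f', R f -> {in P, forall a, hin (f a) ^ g^-1 = hin (f' a)} -> R f'.
Proof.
move=> Rext Rconj Rtwist g f f' Rf E.
have [k [l [+ gE]]] := hnn_evP g; rewrite {g}gE in E.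
elim/last_ind: l f Rf E => [|s [j r] IH] f Rf E red.
  apply: Rext (Rconj f k^-1 Rf) => a aP; apply: (@hin_inj D).
  by rewrite -E // ev_nil mulg1 hinJ hinV.
have fin a : a \in P -> f a ^ r^-1 \in assoc j.
  move=> aP; apply/negPn/negP => nin.
  (* If the twist were undefined at this element, a reduced palindrome would evaluate to [f' a ^ k]
     in the base, against Britton's lemma. *)
  have [sp _] := path_pal 1 (j, r) nin (etrans (esym (sorted_rcons_snd s j r _)) red).
  case: (@britton D _ (f' a ^ k) sp); first by case: (s) => // -[].
  rewrite ev_pal hin1 mulg1 hst_bar -!conjgVE !hinJ -E // ev_rcons hinV.
  by rewrite -!conjgM !invMg mulgVK !mulgA.
apply: (IH _ (Rtwist _ j (Rconj f r^-1 Rf) fin)).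
  move=> a aP; rewrite -E // -hst_hinJ ?fin // ev_rcons hinJ hinV hst_bar.
  by rewrite -conjgVE -!conjgM !invMg !mulgA.
by case: (s) red => //= s0 s'; rewrite rcons_path => /andP[].
Qed.

End Torsion.

(** * Changing the codomain of a morphism in a fusion system *)

Section FusionFacts.

Variables (gT : finGroupType) (S : {group gT}) (F : fusion_system S).
Implicit Types (P Q R : {group gT}) (f : {ffun gT -> gT}).

Lemma fhom_image P Q f : P \subset S -> Q \subset S -> f \in fhom F P Q ->
  exists R : {group gT}, R :=: f @: P.
Proof.
move=> sP sQ /(fs_hom sP sQ)[_ fM _ _].
by exists (Morphism fM @* P)%G; rewrite /= morphimEdom.
Qed.

(** Factor [f] through its image [R], then compose with the inclusion of [R] in [Q'], which is
    conjugation by [1]. *)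
Lemma fhom_cod P Q Q' f : P \subset S -> Q \subset S -> Q' \subset S ->
  f \in fhom F P Q -> f @: P \subset Q' -> f \in fhom F P Q'.
Proof.
move=> sP sQ sQ' fF fQ'; have [R ER] := fhom_image sP sQ fF.
have sRQ' : R \subset Q' by rewrite ER.
have sR : R \subset S := subset_trans sRQ' sQ'.
have [fR _] := fs_iso sP sQ sR fF ER.
have inc : conj_map R 1 \in fhom F R Q'.
  by apply: fs_conj; rewrite ?group1 // invg1 conjsg1.
have := fs_comp sP sR sQ' fR inc.
suff -> : comp_map P (conj_map R 1) f = f by [].
have [f1 _ _ _] := fs_hom sP sQ fF.
apply/ffunP=> x; rewrite ffunE; case: ifPn => [xP|nxP].
  by rewrite ffunE ER imset_f // invg1 conjg1.
by rewrite f1 // inE.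
Qed.

End FusionFacts.

(** * The direct product of the [S i] and the stable letters given by the fusion systems *)

Section Realisation.

Variables (I : finType) (gT : I -> finGroupType) (S : forall i, {group gT i}).
Variable F : forall i, fusion_system (S i).

Definition base_group : finGroupType := {dffun forall i, subg_of (S i)}.

Definition base_in i (x : gT i) : base_group := @dfung1 I (fun i => subg_of (S i)) i (subg (S i) x).
Definition base_pr i (k : base_group) : gT i := sgval (k i).

Lemma base_inM i : {in S i &, {morph @base_in i : x y / x * y}}.
Proof. by move=> x y xS yS; rewrite /base_in morphM // dfung1_morphM. Qed.

Canonical base_in_morphism i := Morphism (@base_inM i).

Lemma base_inK i : {in S i, cancel (@base_in i) (@base_pr i)}.
Proof. by move=> x xS; rewrite /base_pr dfung1_id subgK. Qed.

Lemma base_in_neq i i' (x : gT i) : i != i' -> base_pr i' (base_in x) = 1.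
Proof. by move=> ii'; rewrite /base_pr dfung1_dflt. Qed.

Lemma base_inJ i (x : gT i) k : x \in S i -> base_in x ^ k = base_in (x ^ base_pr i k).
Proof.
move=> xS; apply/ffunP=> i'; rewrite conjgE !ffunE.
have [ii'|ni] := eqVneq i i'; last by rewrite !dfwith_out // mul1g mulVg.
subst i'; rewrite !dfwith_in; apply: val_inj.
by rewrite /= !subgK ?groupJ ?subgP.
Qed.

(* The two maps are mutually inverse; the boolean makes a letter differ from its
   formal inverse even when the map is an involution. *)
Definition pre_letter := {i : I &
  ({group gT i} * {group gT i} * {ffun gT i -> gT i} * {ffun gT i -> gT i} * bool)%type}.

Definition is_letter (u : pre_letter) :=
  let: existT i (P, Q, f, f', _) := u in
  [&& P \subset S i, Q \subset S i, f \in fhom (F i) P Q, f' \in fhom (F i) Q P,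
      [forall x in P, f' (f x) == x] & [forall x in Q, f (f' x) == x]].

Definition swap_pre (u : pre_letter) : pre_letter :=
  let: existT i (P, Q, f, f', b) := u in existT _ i (Q, P, f', f, ~~ b).

Lemma is_letter_swap u : is_letter u -> is_letter (swap_pre u).
Proof. by case: u => i [[[[P Q] f] f'] b] /= /and5P[-> -> -> -> /andP[-> ->]]. Qed.

Definition letter : Type := {u : pre_letter | is_letter u}.
Local Notation Letter lj := (exist (fun u => is_true (is_letter u)) _ lj).
Definition letter_bar (j : letter) : letter := Sub (swap_pre (val j)) (is_letter_swap (valP j)).
Definition letter_dom (j : letter) : {group base_group} :=
  let: existT i (P, _, _, _, _) := val j in (base_in_morphism i @* P)%G.
Definition letter_map (j : letter) (k : base_group) : base_group :=
  let: existT i (_, _, f, _, _) := val j in base_in (f (base_pr i k)).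

Lemma letter_barK : involutive letter_bar.
Proof.
by case=> -[i [[[[P Q] f] f'] b]] lj; apply: val_inj; rewrite /= negbK.
Qed.

Lemma letter_bar_neq j : letter_bar j != j.
Proof.
apply/eqP => /(congr1 (fun j : letter => (tagged (val j)).2)).
by case: j => -[i [[[[P Q] f] f'] []]].
Qed.

Lemma letter_domP i P Q f f' b (lj : is_letter (existT _ i (P, Q, f, f', b))) k :
  k \in letter_dom (Letter lj) -> exists2 x, x \in P & k = base_in x.
Proof. by case/morphimP=> x _ xP ->; exists x. Qed.

Lemma letter_map_dom j :
  {in letter_dom j, forall k, letter_map j k \in letter_dom (letter_bar j)}.
Proof.
case: j => -[i [[[[P Q] f] f'] b]] lj k /letter_domP[x xP ->].
have /and5P[sP sQ fF _ _] := lj; have xS := subsetP sP x xP.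
rewrite /letter_map /letter_dom /= base_inK //.
have [_ _ _ fQ] := fs_hom sP sQ fF.
have fxQ : f x \in Q by apply: subsetP fQ _ _; rewrite imset_f.
by apply: mem_morphim => //; exact: subsetP sQ _ _.
Qed.

Lemma letter_mapM j : {in letter_dom j &, {morph letter_map j : k k' / k * k'}}.
Proof.
case: j => -[i [[[[P Q] f] f'] b]] lj k k' /letter_domP[x xP ->] /letter_domP[y yP ->].
have /and5P[sP sQ fF _ _] := lj.
have [xS yS] := (subsetP sP x xP, subsetP sP y yP).
rewrite /letter_map /= -base_inM // !base_inK ?groupM //.
have [_ fM _ fQ] := fs_hom sP sQ fF.
by rewrite fM // base_inM //; apply: (subsetP sQ); apply: (subsetP fQ); rewrite imset_f.
Qed.

Lemma letter_mapK j :
  {in letter_dom j, cancel (letter_map j) (letter_map (letter_bar j))}.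
Proof.
case: j => -[i [[[[P Q] f] f'] b]] lj k /letter_domP[x xP ->].
have /and5P[sP sQ fF _ /andP[/forallP fK _]] := lj; have xS := subsetP sP x xP.
have [_ _ _ fQ] := fs_hom sP sQ fF.
rewrite /letter_map /= !base_inK //.
  by have /implyP/(_ xP)/eqP -> := fK x.
by apply: (subsetP sQ); apply: (subsetP fQ); rewrite imset_f.
Qed.

Definition fusion_hnn := HNNData letter_barK letter_bar_neq letter_map_dom
  letter_mapM letter_mapK.

(** * The realising group, its Sylow subgroups and its fusion *)

Definition fusion_group : AbsGroup := @MkGroup (hnn fusion_hnn) *%g (fun g => g^-1) 1
  mulgA mul1g mulVg.

Definition fusion_in i (x : gT i) : fusion_group := @hin fusion_hnn (base_in x).

Lemma fusion_gpow (g : hnn fusion_hnn) n : gpow (g : fusion_group) n = g ^+ n.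
Proof. by elim: n => //= n ->; rewrite expgS. Qed.

Lemma fusion_gconj (g x : hnn fusion_hnn) : gconj (g : fusion_group) x = x ^ g^-1.
Proof. by rewrite conjgVE. Qed.

Lemma fusion_embeds i : embeds (S i) (@fusion_in i).
Proof.
split=> [x y xS yS|x y xS yS /hin_inj E]; first by rewrite /fusion_in base_inM // hinM.
by rewrite -(base_inK xS) E base_inK.
Qed.

Lemma fusion_Sylow (p : I -> nat) i :
    (forall i, prime (p i)) -> injective p -> (forall i, (p i).-group (S i)) ->
  is_Sylow_in (p i) (S i) (@fusion_in i).
Proof.
move=> p_pr p_inj pS; split=> // [|H [[_ HM _] Hp]]; first exact: fusion_embeds.
have [|g gP] := @torsion_subgroup_conj fusion_hnn H HM.
  move=> h /Hp[e E]; exists (p i ^ e)%N; first by rewrite expn_gt0 prime_gt0.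
  by rewrite -fusion_gpow.
exists (g^-1 : hnn fusion_hnn) => h Hh; have [k Ek] := gP h Hh.
exists (base_pr i k); first exact: subgP.
rewrite fusion_gconj invgK Ek /fusion_in; congr hin.
have [e] := Hp h Hh; rewrite fusion_gpow => he.
have ke : k ^+ (p i ^ e) = 1.
  apply: (@hin_inj fusion_hnn); rewrite hin1.
  have hX n : hin (k ^+ n) = hin k ^+ n :> hnn fusion_hnn.
    by elim: n => // n IH; rewrite !expgS hinM IH.
  by rewrite hX -Ek -conjXg he conj1g.
(* A coordinate of [k] at [i' != i] has order dividing both a power of [p i] and a power of [p i'],
   so it is trivial. *)
apply/ffunP=> i'; rewrite ffunE.
have [ii'|ni] := eqVneq i i'; first by subst i'; rewrite dfwith_in sgvalK.
rewrite dfwith_out //; apply: val_inj => /=; apply/esym/eqP.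
rewrite -order_eq1 -dvdn1; set y := sgval (k i').
have yp : #[y] %| p i ^ e.
  rewrite order_dvdn; apply/eqP.
  have prX n : sgval ((k ^+ n) i') = y ^+ n.
    by elim: n => [|n IH]; rewrite ?ffunE // !expgS !ffunE /= IH.
  by rewrite -prX ke ffunE.
have yp' : #[y] %| #|S i'| by rewrite order_dvdG // subgP.
have [n En] := p_natP (pS i'); rewrite En in yp'.
have : coprime (p i ^ e) (p i' ^ n).
  rewrite coprimeXl // coprimeXr // prime_coprime ?dvdn_prime2 //.
  by apply: contra ni => /eqP/p_inj->.
by rewrite /coprime => /eqP <-; rewrite dvdn_gcd yp yp'.
Qed.

Lemma fusion_realised i (P Q : {group gT i}) f : P \subset S i -> Q \subset S i ->
  f \in fhom (F i) P Q <-> in_FSG (@fusion_in i) P Q f.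
Proof.
move=> sP sQ; split=> [fF|[f1 [g gP]]].
  have [f1 _ _ fQ] := fs_hom sP sQ fF; split=> //.
  have [R ER] := fhom_image sP sQ fF.
  have sR : R \subset S i by rewrite ER (subset_trans fQ).
  have [fR [f' f'R f'K]] := fs_iso sP sQ sR fF ER.
  (* The stable letter of the isomorphism from [P] onto the image [R] of [f] conjugates [P] by
     [f]. *)
  have lj : is_letter (existT _ i (P, R, f, f', true)).
    rewrite /= sP sR fR f'R /=; apply/andP; split.
      by apply/forallP=> x; apply/implyP=> xP; rewrite f'K.
    apply/forallP=> y; apply/implyP; rewrite ER => /imsetP[x xP ->].
    by rewrite f'K.
  exists (@hst fusion_hnn (Letter lj)) => x xP.
  have xS := subsetP sP x xP.
  split; first by apply: (subsetP fQ); rewrite imset_f.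
  rewrite fusion_gconj conjgVE -hst_bar hst_hinJ.
    by rewrite /fusion_in /= /letter_map /= base_inK.
  by rewrite /= /letter_dom /=; apply: mem_morphim.
(* The codomain is kept at [S i] because the image changes from one letter to the next; it is cut
   down to [Q] at the end. *)
pose R (h : base_group -> base_group) := exists2 f0, f0 \in fhom (F i) P (S i) &
  {in P, forall x, h (base_in x) = base_in (f0 x)}.
have [|||||f0 f0F f0E] := @conj_factor fusion_hnn (@base_in i @: P) R _ _ _ g id
    (fun k => base_in (f (base_pr i k))).
- move=> h h' hh' [f0 f0F f0E]; exists f0 => // x xP.
  by rewrite -hh' ?imset_f // f0E.
- move=> h k [f0 f0F f0E].
  have kS : (base_pr i k)^-1 \in S i by rewrite groupV subgP.
  (* On the factor [S i], conjugation by [k] only sees the coordinate of [k] at [i]; the inverse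
     matches the left conjugation in [conj_map]. *)
  exists (comp_map P (conj_map (S i) (base_pr i k)^-1) f0).
    apply: fs_comp f0F _ => //; apply: fs_conj => //.
    by rewrite conjGid // groupV.
  move=> x xP; have [_ _ _ f0S] := fs_hom sP (subxx _) f0F.
  have fxS : f0 x \in S i by apply: (subsetP f0S); rewrite imset_f.
  by rewrite f0E // base_inJ // !ffunE xP fxS invgK.
- move=> h [[i' [[[[P' Q'] f'] f''] b]] lj] [f0 f0F f0E] h_dom.
  have /and5P[sP' sQ' f'F _ _] := lj.
  have [_ f0M _ f0S] := fs_hom sP (subxx _) f0F.
  have fxS x : x \in P -> f0 x \in S i by move=> xP; apply: (subsetP f0S); rewrite imset_f.
  have f0P' x : x \in P -> exists2 y, y \in P' & base_in (f0 x) = base_in y.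
    by move=> xP; apply: (letter_domP (lj := lj)); rewrite -f0E //; apply: h_dom; rewrite imset_f.
  (* A letter of another index has its associated subgroup in a different factor, so [f0] must be
     trivial on [P] and the twist changes nothing. *)
  have [ii'|ni] := eqVneq i' i; last first.
    exists f0 => // x xP; rewrite /= /letter_map /= f0E //.
    have [y yP' E] := f0P' x xP.
    have fx1 : f0 x = 1 by rewrite -(base_inK (fxS x xP)) E base_in_neq.
    rewrite fx1 base_in_neq 1?eq_sym // morph1.
    have [_ f'M _ _] := fs_hom sP' sQ' f'F.
    suff -> : f' 1 = 1 by rewrite morph1.
    by apply: (mulgI (f' 1)); rewrite -f'M // !mulg1.
  subst i'; have cF : comp_map P f' f0 \in fhom (F i) P Q'.
    apply: (fs_comp sP sP' sQ') f'F; apply: (fhom_cod sP (subxx _)) => //.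
    apply/subsetP=> _ /imsetP[x xP ->]; have [y yP' E] := f0P' x xP.
    by rewrite -(base_inK (fxS x xP)) E base_inK // (subsetP sP').
  have [_ _ _ cQ'] := fs_hom sP sQ' cF.
  exists (comp_map P f' f0); first exact: fhom_cod cF (subset_trans cQ' sQ').
  move=> x xP; rewrite /= /letter_map /= f0E // base_inK ?fxS //.
  by rewrite ffunE xP.
- exists (conj_map P 1); first by apply: fs_conj; rewrite // invg1 conjsg1.
  by move=> x xP; rewrite ffunE xP invg1 conjg1.
- move=> _ /imsetP[x xP ->]; have [_ E] := gP x xP.
  by rewrite -fusion_gconj base_inK ?(subsetP sP) //.
have [f01 _ _ f0S] := fs_hom sP (subxx _) f0F.
have fQ : f @: P \subset Q by apply/subsetP=> _ /imsetP[x /gP[fx _] ->].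
suff Ef : f = f0 by apply: (fhom_cod sP (subxx _)) => //; rewrite Ef.
apply/ffunP=> x; have [xP|nxP] := boolP (x \in P); last first.
  by rewrite f1 ?f01 ?inE.
have fxS : f x \in S i by apply: (subsetP sQ); case: (gP x xP).
have f0xS : f0 x \in S i by apply: (subsetP f0S); rewrite imset_f.
have := f0E x xP; rewrite base_inK ?(subsetP sP) // => E.
by rewrite -(base_inK fxS) E base_inK.
Qed.

End Realisation.

Theorem theorem3p3 (m : nat) (gT : 'I_m -> finGroupType)
    (S : forall i, {group gT i}) (p : 'I_m -> nat)
    (p_prime : forall i, prime (p i)) (p_distinct : injective p)
    (S_pgroup : forall i, ((p i).-group (S i))%g)
    (F : forall i, fusion_system (S i)) :
  exists (G : AbsGroup) (iota : forall i, gT i -> G),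
    forall i,
      @is_Sylow_in G (p i) (gT i) (S i) (iota i) /\
      (forall P Q : {group gT i}, P \subset S i -> Q \subset S i ->
         forall f : {ffun gT i -> gT i},
           f \in fhom (F i) P Q <-> @in_FSG (gT i) G (iota i) P Q f).
Proof.
exists (fusion_group F), (fusion_in F) => i; split; first exact: fusion_Sylow.
by move=> P Q sP sQ f; exact: fusion_realised.
Qed.
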